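(* Let $\mathcal{A}$ and $\mathcal{B}$ be $C^{*}$-algebras, let $\Xi$ be a Hilbert $\mathcal{A}$-module and $\nabla$ a Hilbert $\mathcal{B}$-module. Let $f:\Xi \rightarrow \nabla$ be a mapping for which there exists a function $\varphi:\Xi^{3}\rightarrow[0,\infty)$ such that $$\| f(\mu x+y)-\mu f(x)-f(y)\| \leq \varphi(x,y,0),$$ $$\| f(\langle x,y\rangle z)-\langle f(x),f(y)\rangle f(z)\| \leq \varphi(x,y,z),$$ $$\| f(\langle x,y\rangle^{*} z)-\langle f(x),f(y)\rangle^{*} f(z)\| \leq \varphi(x,y,z)$$ for all $x,y,z\in\Xi$ and all $\mu\in\mathbb{T}$. If there exists $0\leq L<1$ such that $\varphi(x,y,z)\leq \frac{L}{8}\varphi(2x,2y,2z)$ for all $x,y,z\in\Xi$, then there exists a unique Hilbert $C^{*}$-module $\ast$-homomorphism $H:\Xi\rightarrow\nabla$ such that $$\|f(x)-H(x)\|\leq \frac{L}{8-8L}\varphi(x,x,0)$$ for all $x\in\Xi$.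
   Context: $\mathbb{T}=\{z\in\mathbb{C}:|z|=1\}$. For a $C^{*}$-algebra $\mathcal{A}$, a (left) Hilbert $\mathcal{A}$-module is a complex linear space $\Xi$ with a compatible left $\mathcal{A}$-module action ($\lambda(ax)=(\lambda a)x=a(\lambda x)$) and a map $\langle\cdot,\cdot\rangle:\Xi\times\Xi\to\mathcal{A}$ that is linear in the first variable, satisfies $\langle ax,y\rangle=a\langle x,y\rangle$, $\langle x,y\rangle^{*}=\langle y,x\rangle$, $\langle x,x\rangle\geq 0$ with equality iff $x=0$, and such that $\Xi$ is complete in the norm $\|x\|=\|\langle x,x\rangle\|^{1/2}$. For a Hilbert $\mathcal{A}$-module $\Xi$ and a Hilbert $\mathcal{B}$-module $\nabla$, a Hilbert $C^{*}$-module homomorphism is a $\mathbb{C}$-linear map $H:\Xi\to\nabla$ with $H(\langle x,y\rangle z)=\langle H(x),H(y)\rangle H(z)$ for all $x,y,z\in\Xi$; it is a Hilbert $C^{*}$-module $\ast$-homomorphism if moreover $H(\langle x,y\rangle^{*} z)=\langle H(x),H(y)\rangle^{*} H(z)$ for all $x,y,z\in\Xi$. *)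

(* Defs.v *)
From HB Require Import structures.
From mathcomp Require Import all_boot all_order all_algebra.
From mathcomp Require Import all_classical reals.
From mathcomp Require Import complex.
Set Implicit Arguments. Unset Strict Implicit. Unset Printing Implicit Defensive.
Import Order.TTheory GRing.Theory Num.Theory.
Local Open Scope ring_scope.

Section Defs.
Variable R : realType.
Local Notation C := (R[i]).

Definition cabs (c : C) : R := ComplexField.Normc.normc c.

Definition is_norm (V : lmodType C) (nrm : V -> R) : Prop :=
  [/\ forall x, 0 <= nrm x,
      forall x, nrm x = 0 -> x = 0,
      forall x y, nrm (x + y) <= nrm x + nrm y &
      forall (c : C) x, nrm (c *: x) = cabs c * nrm x].

Definition complete_for (V : lmodType C) (nrm : V -> R) : Prop :=
  forall u : nat -> V,
    (forall e : R, 0 < e -> exists N : nat, forall m n : nat,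
        (N <= m)%N -> (N <= n)%N -> nrm (u m - u n) < e) ->
    exists l : V, forall e : R, 0 < e -> exists N : nat, forall n : nat,
        (N <= n)%N -> nrm (u n - l) < e.

(* A (not necessarily unital) C*-algebra *)
Record CstarAlg := {
  ca_car :> lmodType C;
  ca_mul : ca_car -> ca_car -> ca_car;
  ca_star : ca_car -> ca_car;
  ca_norm : ca_car -> R;
  ca_mulA : forall a b c, ca_mul a (ca_mul b c) = ca_mul (ca_mul a b) c;
  ca_mulDl : forall a b c, ca_mul (a + b) c = ca_mul a c + ca_mul b c;
  ca_mulDr : forall a b c, ca_mul a (b + c) = ca_mul a b + ca_mul a c;
  ca_mulZl : forall (l : C) a b, ca_mul (l *: a) b = l *: ca_mul a b;
  ca_mulZr : forall (l : C) a b, ca_mul a (l *: b) = l *: ca_mul a b;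
  ca_starD : forall a b, ca_star (a + b) = ca_star a + ca_star b;
  ca_starZ : forall (l : C) a, ca_star (l *: a) = Num.conj l *: ca_star a;
  ca_starK : forall a, ca_star (ca_star a) = a;
  ca_starM : forall a b, ca_star (ca_mul a b) = ca_mul (ca_star b) (ca_star a);
  ca_normP : is_norm ca_norm;
  ca_normM : forall a b, ca_norm (ca_mul a b) <= ca_norm a * ca_norm b;
  ca_normC : forall a, ca_norm (ca_mul (ca_star a) a) = ca_norm a ^+ 2;
  ca_complete : complete_for ca_norm
}.

Definition ca_pos (A : CstarAlg) (a : A) : Prop :=
  exists b : A, a = ca_mul (ca_star b) b.

Record HilbMod (A : CstarAlg) := {
  hm_car :> lmodType C;
  hm_act : A -> hm_car -> hm_car;
  hm_ip : hm_car -> hm_car -> A;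
  hm_actDl : forall (a b : A) x, hm_act (a + b) x = hm_act a x + hm_act b x;
  hm_actDr : forall (a : A) x y, hm_act a (x + y) = hm_act a x + hm_act a y;
  hm_actM : forall (a b : A) x, hm_act (ca_mul a b) x = hm_act a (hm_act b x);
  hm_actZl : forall (l : C) (a : A) x, hm_act (l *: a) x = l *: hm_act a x;
  hm_actZr : forall (l : C) (a : A) x, hm_act a (l *: x) = l *: hm_act a x;
  hm_ipDl : forall x y z, hm_ip (x + y) z = hm_ip x z + hm_ip y z;
  hm_ipZl : forall (l : C) x y, hm_ip (l *: x) y = l *: hm_ip x y;
  hm_ipA : forall (a : A) x y, hm_ip (hm_act a x) y = ca_mul a (hm_ip x y);
  hm_ipC : forall x y, ca_star (hm_ip x y) = hm_ip y x;
  hm_ip_pos : forall x, ca_pos (hm_ip x x);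
  hm_ip_def : forall x, hm_ip x x = 0 -> x = 0;
  hm_complete : complete_for (fun x => Num.sqrt (ca_norm (hm_ip x x)))
}.

Definition hnorm (A : CstarAlg) (X : HilbMod A) (x : X) : R :=
  Num.sqrt (ca_norm (hm_ip x x)).

Definition is_hm_hom (A B : CstarAlg) (X : HilbMod A) (Y : HilbMod B)
    (H : X -> Y) : Prop :=
  (forall (l : C) (x y : X), H (l *: x + y) = l *: H x + H y) /\
  (forall x y z : X,
     H (hm_act (hm_ip x y) z) = hm_act (hm_ip (H x) (H y)) (H z)).

Definition is_hm_star_hom (A B : CstarAlg) (X : HilbMod A) (Y : HilbMod B)
    (H : X -> Y) : Prop :=
  is_hm_hom H /\
  (forall x y z : X,
     H (hm_act (ca_star (hm_ip x y)) z)
     = hm_act (ca_star (hm_ip (H x) (H y))) (H z)).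

End Defs.

(* Main.v *)
Require Import Defs.
From HB Require Import structures.
From mathcomp Require Import all_boot all_order all_algebra.
From mathcomp Require Import all_classical reals.
From mathcomp Require Import complex.
From mathcomp Require Import ring lra.
Set Implicit Arguments. Unset Strict Implicit. Unset Printing Implicit Defensive.
Import Order.TTheory GRing.Theory Num.Theory.
Local Open Scope ring_scope.
Local Open Scope complex_scope.

(* The limit [H x] of [2^n f(x / 2^n)] exists because the increments are
   dominated by a geometric series of ratio [L / 4]; it commutes with
   unimodular scalars, hence with all complex scalars, and the module identities
   pass to the limit because their defect, rescaled by [8^n], is at most
   [L^n phi x y z].
   That [hnorm] is a norm is where the work lies: it rests on the
   Cauchy-Schwarz inequality, hence on positivity in C*-algebras. In the
   unitization, call a self-adjoint [h] positive if [||t - h|| <= t] for some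
   [t >= 0]; such elements obviously form a convex cone. The Visser iteration
   [s_(n+1) = (x + s_n^2) / 2] gives [1 - sqrt (1 - x)], hence square roots, and
   commuting self-adjoint [k, w] with [k^2 + w^2 = t^2] satisfy [||k|| <= t]
   because [k + i w] is [t] times a unitary. This makes squares of self-adjoint
   elements positive and the norm monotone on the cone, and yields Kaplansky's
   theorem that every [c^* c] is positive. *)

(** * The modulus of complex numbers *)

Section Cabs.
Variable R : realType.
Implicit Types c d : R[i].

Lemma cabsE c : `|c| = (cabs c)%:C.
Proof. by case: c => a b; rewrite normc_def. Qed.

Lemma cabs_ge0 c : 0 <= cabs c.
Proof. by rewrite -ler0c -cabsE. Qed.

Lemma cabsR (r : R) : 0 <= r -> cabs r%:C = r.
Proof.
by move=> r0; apply: (@complexI R); rewrite -cabsE ger0_norm // ler0c.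
Qed.

Lemma cabsM c d : cabs (c * d) = cabs c * cabs d.
Proof. exact: ComplexField.Normc.normcM. Qed.

Lemma cabsD c d : cabs (c + d) <= cabs c + cabs d.
Proof. exact: le_normcD. Qed.

Lemma cabsJ c : cabs (Num.conj c) = cabs c.
Proof. by apply: (@complexI R); rewrite -!cabsE norm_conjC. Qed.

Lemma conj_real (r : R) : Num.conj (r%:C) = r%:C.
Proof. by apply/CrealP; apply/complex_realP; exists r. Qed.

Lemma cabsi : cabs ('i : R[i]) = 1.
Proof. by apply: (@complexI R); rewrite -cabsE normCi. Qed.

End Cabs.

(** * Convergence with respect to a norm given as a function *)

Section Limits.
Variable R : realType.

Definition tends (V : lmodType R[i]) (nrm : V -> R) (u : nat -> V) (l : V) :=
  forall e : R, 0 < e -> exists N, forall n, (N <= n)%N -> nrm (u n - l) < e.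

Section OneSpace.
Variables (V : lmodType R[i]) (nrm : V -> R).
Hypothesis nP : is_norm nrm.

Lemma nrm_ge0 x : 0 <= nrm x. Proof. by case: nP. Qed.
Lemma nrm0_eq0 x : nrm x = 0 -> x = 0.
Proof. by case: nP => _ h _ _; apply: h. Qed.
Lemma nrmD x y : nrm (x + y) <= nrm x + nrm y. Proof. by case: nP. Qed.
Lemma nrmZ c x : nrm (c *: x) = cabs c * nrm x. Proof. by case: nP. Qed.

Lemma nrmZR (r : R) x : 0 <= r -> nrm (r%:C *: x) = r * nrm x.
Proof. by move=> r0; rewrite nrmZ cabsR. Qed.

Lemma nrm0 : nrm 0 = 0.
Proof. by rewrite -(scale0r 0) -[0 in X in nrm X]/(0%:C) nrmZR // mul0r. Qed.

Lemma nrmN x : nrm (- x) = nrm x.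
Proof.
rewrite -scaleN1r nrmZ /cabs normcN.
by rewrite ComplexField.Normc.normc1 mul1r.
Qed.

Lemma nrmBC x y : nrm (x - y) = nrm (y - x).
Proof. by rewrite -nrmN opprB. Qed.

Lemma nrmB x y : nrm (x - y) <= nrm x + nrm y.
Proof. by rewrite -(nrmN y) nrmD. Qed.

Lemma nrmB3 y x z : nrm (x - z) <= nrm (x - y) + nrm (y - z).
Proof. by apply: le_trans (nrmD _ _); rewrite addrA subrK. Qed.

Lemma nrm_le_eps_eq0 x : (forall e, 0 < e -> nrm x <= e) -> x = 0.
Proof.
move=> h; apply: nrm0_eq0; apply/le_anti; rewrite nrm_ge0 andbT.
by apply/ler_addgt0Pr => e e0; rewrite add0r h.
Qed.

Lemma tends_cst x : tends nrm (fun=> x) x.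
Proof. by move=> e e0; exists 0%N => n _; rewrite subrr nrm0. Qed.

Lemma tends_uniq u x y : tends nrm u x -> tends nrm u y -> x = y.
Proof.
move=> ux uy; apply/subr0_eq/nrm_le_eps_eq0 => e e0.
have e20 : 0 < e / 2 by rewrite divr_gt0.
have [N1 h1] := ux _ e20; have [N2 h2] := uy _ e20.
have := h1 _ (leq_maxl N1 N2); have := h2 _ (leq_maxr N1 N2).
set n := maxn _ _ => a b; apply: le_trans (nrmB3 (u n) _ _) _.
by rewrite nrmBC (splitr e) lerD // ltW.
Qed.

Lemma tends_sub u l (k : nat -> nat) : (forall n, (n <= k n)%N) ->
  tends nrm u l -> tends nrm (u \o k) l.
Proof.
move=> kn ul e e0; have [N h] := ul e e0; exists N => n Nn.
by apply: h; apply: leq_trans (kn n).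
Qed.

Lemma tendsD u v x y : tends nrm u x -> tends nrm v y ->
  tends nrm (fun n => u n + v n) (x + y).
Proof.
move=> ux uy e e0.
have e20 : 0 < e / 2 by rewrite divr_gt0.
have [N1 h1] := ux _ e20; have [N2 h2] := uy _ e20.
exists (maxn N1 N2) => n; rewrite geq_max => /andP[/h1 a /h2 b].
rewrite opprD addrACA (splitr e); apply: le_lt_trans (nrmD _ _) _.
exact: ltrD.
Qed.

Lemma tendsZ u x c : tends nrm u x -> tends nrm (fun n => c *: u n) (c *: x).
Proof.
move=> ux e e0.
have c1 : 0 < cabs c + 1 by rewrite ltr_wpDl ?cabs_ge0.
have [N h] := ux _ (divr_gt0 e0 c1); exists N => n /h a.
rewrite -scalerBr nrmZ; move: a; rewrite ltr_pdivlMr // => a.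
by have := cabs_ge0 c; have := nrm_ge0 (u n - x); nra.
Qed.

Lemma tends_bound u x y (M : R) :
  tends nrm u x -> (forall n, nrm (u n - y) <= M) -> nrm (x - y) <= M.
Proof.
move=> ux h; apply/ler_addgt0Pr => e e0; have [N hN] := ux e e0.
apply: le_trans (nrmB3 (u N) _ _) _.
by rewrite [M + e]addrC lerD ?h // ltW // nrmBC hN.
Qed.

End OneSpace.

(** Only additivity in each slot is asked, so that the sesquilinear inner product is covered along
    with the algebra product and the module action. *)
Lemma tends_bilin (V1 V2 V3 : lmodType R[i]) (n1 : V1 -> R) (n2 : V2 -> R)
    (n3 : V3 -> R) (m : V1 -> V2 -> V3) u v x y :
  is_norm n1 -> is_norm n2 -> is_norm n3 ->
  (forall a b c, m (a + b) c = m a c + m b c) ->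
  (forall a b c, m a (b + c) = m a b + m a c) ->
  (forall a b, n3 (m a b) <= n1 a * n2 b) ->
  tends n1 u x -> tends n2 v y -> tends n3 (fun n => m (u n) (v n)) (m x y).
Proof.
move=> P1 P2 P3 mDl mDr mM ux vy e e0.
have x0 := nrm_ge0 P1 x; have y0 := nrm_ge0 P2 y.
(* As [d <= 1], the three error terms add up to at most [d * (1 + n1 x + n2 y)]; the 2 in [K] makes
   the final inequality strict. *)
pose K := 2 + n1 x + n2 y; have K0 : 0 < K by rewrite /K; lra.
pose d := Num.min 1 (e / K).
have d0 : 0 < d by rewrite /d lt_min ltr01 divr_gt0.
have d1 : d <= 1 by rewrite /d ge_min lexx.
have dK : d * K <= e by rewrite -ler_pdivlMr // /d ge_min lexx orbT.
have [N1 h1] := ux _ d0; have [N2 h2] := vy _ d0.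
exists (maxn N1 N2) => n; rewrite geq_max => /andP[/h1 a /h2 b].
have -> : m (u n) (v n) - m x y
    = m (u n - x) (v n - y) + (m (u n - x) y + m x (v n - y)).
  rewrite addrA -mDr subrK.
  have -> : m (u n) (v n) = m (u n - x) (v n) + m x (v n) by rewrite -mDl subrK.
  rewrite -addrA; congr (_ + _).
  by apply/eqP; rewrite subr_eq -mDr subrK.
have B1 : n3 (m (u n - x) (v n - y)) <= d * d.
  by apply: le_trans (mM _ _) _; rewrite ler_pM ?nrm_ge0 // ltW.
have B2 : n3 (m (u n - x) y) <= d * n2 y.
  by apply: le_trans (mM _ _) _; rewrite ler_pM ?nrm_ge0 // ltW.
have B3 : n3 (m x (v n - y)) <= n1 x * d.
  by apply: le_trans (mM _ _) _; rewrite ler_pM ?nrm_ge0 // ltW.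
have D1 := nrmD P3 (m (u n - x) (v n - y)) (m (u n - x) y + m x (v n - y)).
have D2 := nrmD P3 (m (u n - x) y) (m x (v n - y)).
by move: dK; rewrite /K; nra.
Qed.

End Limits.

(** * Positive elements of unital C*-algebras *)

(** Built on [algType], which gives access to the ring lemmas and provides [1 != 0], whence
    [norm1]. *)
Record ucstar (R : realType) := {
  uc_car :> algType R[i];
  uc_star : uc_car -> uc_car;
  uc_norm : uc_car -> R;
  uc_starD : forall a b, uc_star (a + b) = uc_star a + uc_star b;
  uc_starZ : forall (l : R[i]) a, uc_star (l *: a) = Num.conj l *: uc_star a;
  uc_starK : forall a, uc_star (uc_star a) = a;
  uc_starM : forall a b, uc_star (a * b) = uc_star b * uc_star a;
  uc_normP : is_norm uc_norm;
  uc_normM : forall a b, uc_norm (a * b) <= uc_norm a * uc_norm b;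
  uc_normC : forall a, uc_norm (uc_star a * a) = uc_norm a ^+ 2;
  uc_complete : complete_for uc_norm
}.

(** * The scalar Visser iteration *)

Section VisserIteration.
Variable R : realType.

(** The iteration [viter] in the scalar case [x = 1]. It is increasing and bounded by 1, hence
    Cauchy, and this alone gives convergence in the algebra. *)
Fixpoint vseq (n : nat) : R := if n is m.+1 then (1 + vseq m ^+ 2) / 2 else 0.

Lemma vseq_bnd n : 0 <= vseq n <= 1.
Proof. by elim: n => [|n /andP[a b]] /=; [rewrite lexx ler01|nra]. Qed.

Lemma vseq_leS n : vseq n <= vseq n.+1.
Proof. by rewrite /=; have := sqr_ge0 (1 - vseq n); nra. Qed.

Lemma vseq_mono m n : (m <= n)%N -> vseq m <= vseq n.
Proof.
move/subnKC <-; elim: (n - m)%N => [|k IH]; first by rewrite addn0.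
by rewrite addnS; apply: le_trans IH (vseq_leS _).
Qed.

Lemma vseq_cauchy e : 0 < e -> exists N, forall m n,
  (N <= m)%N -> (m <= n)%N -> vseq n - vseq m < e.
Proof.
move=> e0; pose E := [set vseq n | n in [set: nat]]%classic.
have hE : has_sup E.
  split; first by exists (vseq 0); exists 0%N.
  by exists 1 => _ [n _ <-]; case/andP: (vseq_bnd n).
have [_ [N _ <-] hN] := sup_adherent e0 hE.
exists N => m n Nm _; have := vseq_mono Nm.
have : vseq n <= sup E by apply: sup_upper_bound => //; exists n.
by move: hN; lra.
Qed.

End VisserIteration.

(** * Square roots and the positive cone in a unital C*-algebra *)

Section UnitalCstar.
Variables (R : realType) (U : ucstar R).
Local Notation N := (@uc_norm R U).
Local Notation star := (@uc_star R U).
Local Notation nP := (@uc_normP R U).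
Implicit Types (a b c e g h k p s u v w x y : U) (r t : R).

Lemma star0 : star 0 = 0.
Proof. by apply: (addrI (star 0)); rewrite -uc_starD !addr0. Qed.

Lemma starN x : star (- x) = - star x.
Proof. by apply/eqP; rewrite -addr_eq0 -uc_starD addNr star0. Qed.

Lemma starB x y : star (x - y) = star x - star y.
Proof. by rewrite uc_starD starN. Qed.

Lemma starZR r x : star (r%:C *: x) = r%:C *: star x.
Proof. by rewrite uc_starZ conj_real. Qed.

Lemma star1 : star 1 = 1.
Proof. by rewrite -[LHS]mulr1 -{2}(uc_starK 1) -uc_starM mulr1 uc_starK. Qed.

Lemma norm_star x : N (star x) = N x.
Proof.
suff le y : N y <= N (star y).
  by apply/le_anti; rewrite -{2}(uc_starK x) !le.
have := uc_normM (star y) y; rewrite uc_normC expr2.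
have [->|y0] := eqVneq (N y) 0; first by rewrite nrm_ge0 //; exact: nP.
by rewrite ler_pM2r // lt_def y0 nrm_ge0 //; exact: nP.
Qed.

Lemma norm_sa_sqr x : star x = x -> N (x * x) = N x ^+ 2.
Proof. by move=> sx; rewrite -uc_normC sx. Qed.

Lemma norm_ge0 x : 0 <= N x. Proof. exact: nrm_ge0 nP x. Qed.

Lemma norm1 : N 1 = 1.
Proof.
have := uc_normC (1 : U); rewrite star1 mulr1 expr2 => h.
have n0 : N 1 != 0.
  by apply/eqP => /(nrm0_eq0 nP)/eqP; rewrite oner_eq0.
by apply: (mulfI n0); rewrite -h mulr1.
Qed.

Lemma tends_mul (u v : nat -> U) x y : tends N u x -> tends N v y ->
  tends N (fun n => u n * v n) (x * y).
Proof.
by apply: (tends_bilin nP nP nP); [exact: mulrDl|exact: mulrDr|exact: uc_normM].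
Qed.

Lemma tends_star (u : nat -> U) x : tends N u x ->
  tends N (star \o u) (star x).
Proof.
move=> h e e0; have [M hM] := h e e0; exists M => n /hM.
by rewrite /= -starB norm_star.
Qed.

Fixpoint viter x (n : nat) : U :=
  if n is m.+1 then (2^-1)%:C *: (x + viter x m * viter x m) else 0.

Lemma viter_comm x y n : x * y = y * x -> viter x n * y = y * viter x n.
Proof.
move=> h; elim: n => [|n IH] /=; first by rewrite mul0r mulr0.
rewrite -scalerAl -scalerAr; congr (_ *: _).
by rewrite mulrDl mulrDr h -mulrA IH !mulrA IH.
Qed.

Lemma viter_star x n : star x = x -> star (viter x n) = viter x n.
Proof.
move=> sx; elim: n => [|n IH] /=; first exact: star0.
by rewrite starZR uc_starD sx uc_starM IH.
Qed.

Lemma viter_norm x n : N x <= 1 -> N (viter x n) <= vseq R n.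
Proof.
move=> x1; elim: n => [|n IH] /=; first by rewrite (nrm0 nP).
rewrite (nrmZR nP) ?invr_ge0 //.
have a := nrmD nP x (viter x n * viter x n).
have b := uc_normM (viter x n) (viter x n).
by have := norm_ge0 (viter x n); have := vseq_bnd R n; nra.
Qed.

(* The scalar sequence started at [x = 1] dominates all increments. *)
Lemma viter_dist x m n : N x <= 1 -> (m <= n)%N ->
  N (viter x n - viter x m) <= vseq R n - vseq R m.
Proof.
move=> x1 /subnKC <-; move: (n - m)%N => d; elim: m => [|m IH].
  by rewrite /= !subr0; apply: viter_norm.
rewrite addSn /= -scalerBr opprD addrACA subrr add0r.
set a := viter x (m + d) in IH *; set b := viter x m in IH *.
(* Iterates at [x] commute, so the difference of squares factors exactly as for the scalar
   sequence. *)
have ab : a * b = b * a.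
  by apply: viter_comm; apply/esym/viter_comm.
have -> : a * a - b * b = (a - b) * (a + b).
  by rewrite mulrBl !mulrDr opprD ab addrA addrK.
rewrite (nrmZR nP) ?invr_ge0 //.
have := uc_normM (a - b) (a + b); have := nrmD nP a b.
have := viter_norm m x1; have := viter_norm (m + d) x1.
have := norm_ge0 (a - b); have := norm_ge0 (a + b).
rewrite -/a -/b; move: IH; set N1 := (m + d)%N.
have := vseq_bnd R m; have := vseq_bnd R N1.
by nra.
Qed.

(** The limit [s] of [viter x] satisfies [2 s = x + s^2], because the shifted sequence has the same
    limit; this rearranges to [(1 - s)^2 = 1 - x]. Self-adjointness, the norm bound and the
    commutation relations pass from the iterates to [s]. *)
Lemma sqrt_complement x : star x = x -> N x <= 1 ->
  exists s, [/\ star s = s, N s <= 1, (1 - s) * (1 - s) = 1 - x &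
    forall y, x * y = y * x -> s * y = y * s].
Proof.
move=> sx x1.
have [s us] : exists s, tends N (viter x) s.
  apply: uc_complete => e e0; have [M h] := vseq_cauchy e0.
  exists M => m n; wlog mn : m n / (m <= n)%N => [W Mm Mn|Mm Mn].
    by case/orP: (leq_total m n) => /W; last rewrite nrmBC //; auto; exact: nP.
  rewrite nrmBC; last exact: nP.
  exact: le_lt_trans (viter_dist x1 mn) (h _ _ Mm mn).
have comm y : x * y = y * x -> s * y = y * s.
  move=> xy; apply: (tends_uniq nP (u := fun n => viter x n * y)).
    exact: tends_mul us (tends_cst nP y).
  have -> : (fun n => viter x n * y) = (fun n => y * viter x n).
    by apply/funext => n; rewrite viter_comm.
  exact: tends_mul (tends_cst nP y) us.
exists s; split => //.
- apply: (tends_uniq nP _ us).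
  have {1}-> : viter x = star \o viter x by apply/funext => n; rewrite /= viter_star.
  exact: tends_star.
- rewrite -[s]subr0; apply: (tends_bound nP us) => n; rewrite subr0.
  by apply: le_trans (viter_norm n x1) _; case/andP: (vseq_bnd R n).
- have e : s = (2^-1)%:C *: (x + s * s).
    apply: (tends_uniq nP (u := viter x \o succn)).
      exact: (tends_sub (k := succn)).
    apply: (tendsZ nP (u := fun n => x + viter x n * viter x n)).
    exact: tendsD nP _ _ _ _ (tends_cst nP x) (tends_mul us us).
  have e2 : s + s = x + s * s.
    rewrite {1 2}e -scalerDl -rmorphD /= -[_^-1]div1r -splitr.
    by rewrite scale1r.
  have -> : x = s + s - s * s by rewrite e2 addrK.
  by rewrite mulrBl mul1r mulrBr mulr1 -addrA -opprD addrA.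
Qed.

(** For self-adjoint [h] the norm inequality says that the spectrum lies in [[0, 2t]], expressed
    here without spectral theory. *)
Definition pos h := star h = h /\ exists2 t, 0 <= t & N (t%:C *: 1 - h) <= t.

Lemma pos0 : pos 0.
Proof. by split; [exact: star0|exists 0; rewrite // scale0r subr0 (nrm0 nP)]. Qed.

Lemma posD h k : pos h -> pos k -> pos (h + k).
Proof.
move=> [sh [t t0 ht]] [sk [r r0 kr]]; split; first by rewrite uc_starD sh sk.
exists (t + r); first exact: addr_ge0.
rewrite rmorphD /= scalerDl opprD addrACA.
by apply: le_trans (nrmD nP _ _) _; exact: lerD.
Qed.

Lemma posZ r h : 0 <= r -> pos h -> pos (r%:C *: h).
Proof.
move=> r0 [sh [t t0 ht]]; split; first by rewrite starZR sh.
exists (r * t); first exact: mulr_ge0.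
by rewrite rmorphM /= -scalerA -scalerBr (nrmZR nP) // ler_wpM2l.
Qed.

Lemma realZM r t x y : (r%:C *: x) * (t%:C *: y) = (r * t)%:C *: (x * y).
Proof. by rewrite -scalerAl -scalerAr scalerA rmorphM. Qed.

Lemma scalar_comm (l : R[i]) x : (l *: 1) * x = x * (l *: 1).
Proof. by rewrite -scalerAl -scalerAr mul1r mulr1. Qed.

(** After scaling, [x = 1 - h / T] has norm at most 1, and the [s] of [sqrt_complement] gives the
    root [sqrt T (1 - s)]. *)
Lemma pos_sqrt h : pos h -> exists k, [/\ star k = k, pos k, k * k = h &
  forall y, h * y = y * h -> k * y = y * k].
Proof.
(* The given [t] may be 0, while [T] has to be inverted; enlarging [t] preserves the inequality. *)
move=> [sh [t t0 ht]]; pose T := t + 1.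
have T0 : 0 < T by rewrite /T ltr_wpDl.
have TN0 : T%:C != 0 by rewrite eq_complex /= eqxx andbT gt_eqF.
have hT : N (T%:C *: 1 - h) <= T.
  rewrite /T rmorphD /= scalerDl scale1r addrAC.
  by apply: le_trans (nrmD nP _ _) _; rewrite norm1 lerD2r.
pose x := 1 - T^-1%:C *: h.
have sx : star x = x by rewrite /x starB star1 starZR sh.
have x1 : N x <= 1.
  have -> : x = T^-1%:C *: (T%:C *: 1 - h).
    by rewrite scalerBr scalerA -rmorphM /= mulVf ?scale1r // gt_eqF.
  by rewrite (nrmZR nP) ?invr_ge0 ?(ltW T0) // ler_pdivrMl // mulr1.
have [s [ss s1 sE sC]] := sqrt_complement sx x1.
have sq0 : 0 <= Num.sqrt T by exact: sqrtr_ge0.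
have sqT : Num.sqrt T * Num.sqrt T = T by rewrite -expr2 sqr_sqrtr // ltW.
exists ((Num.sqrt T)%:C *: (1 - s)); split.
- by rewrite starZR starB star1 ss.
- split; first by rewrite starZR starB star1 ss.
  exists (Num.sqrt T) => //.
  by rewrite -scalerBr subKr (nrmZR nP) // ler_piMr.
- by rewrite realZM sqT sE /x subKr scalerA -rmorphM /= mulfV ?scale1r // gt_eqF.
- move=> y hy; rewrite -scalerAl -scalerAr mulrBl mulrBr mul1r mulr1 sC //.
  by rewrite /x mulrBl mulrBr mul1r mulr1 -scalerAl -scalerAr hy.
Qed.

(* [k + i w] is [t] times a unitary, and [k] is its real part. *)
Lemma circle_bound k w t : 0 <= t -> star k = k -> star w = w ->
  k * w = w * k -> k * k + w * w = (t ^+ 2)%:C *: 1 -> N k <= t.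
Proof.
move=> t0 sk sw kw e; pose u := k + 'i *: w.
have su : star u = k - 'i *: w.
  by rewrite uc_starD uc_starZ sk sw conjCi scaleNr.
have Nu : N u = t.
  apply/eqP; rewrite -(eqrXn2 (n := 2)) ?norm_ge0 //; apply/eqP.
  rewrite -uc_normC su mulrBl !mulrDr -!scalerAl -!scalerAr scalerA.
  rewrite -['i * _]expr2 sqrCi.
  rewrite kw scaleN1r opprD opprK addrA addrK.
  by rewrite e (nrmZR nP) ?sqr_ge0 // norm1 mulr1.
have -> : k = 2^-1%:C *: (u + star u).
  rewrite su addrACA subrr addr0 -mulr2n -scaler_nat scalerA.
  have -> : (2%:R : R[i]) = 2%:C by rewrite rmorph_nat.
  by rewrite -rmorphM /= mulVf ?pnatr_eq0 // scale1r.
rewrite (nrmZR nP) ?invr_ge0 // ler_pdivrMl //.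
by apply: le_trans (nrmD nP _ _) _; rewrite norm_star Nu -mulr2n mulr_natl.
Qed.

(** The witness is [t] times the root of [1 - (k / t)^2], which commutes with [k]. *)
Lemma circle_complement k t : 0 < t -> star k = k -> N k <= t ->
  exists w, [/\ star w = w, k * w = w * k & k * k + w * w = (t ^+ 2)%:C *: 1].
Proof.
move=> t0 sk kt; pose x := (t ^- 2)%:C *: (k * k).
have t20 : 0 <= t ^- 2 by rewrite invr_ge0 sqr_ge0.
have sx : star x = x by rewrite starZR uc_starM sk.
have x1 : N x <= 1.
  rewrite (nrmZR nP) // norm_sa_sqr // ler_pdivrMl ?exprn_gt0 // mulr1.
  by rewrite lerXn2r ?nnegrE ?norm_ge0 // ltW.
have [s [ss s1 sE sC]] := sqrt_complement sx x1.
have sk2 : s * k = k * s.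
  by apply: sC; rewrite -scalerAl -scalerAr mulrA.
exists (t%:C *: (1 - s)); split.
- by rewrite starZR starB star1 ss.
- by rewrite -scalerAl -scalerAr mulrBl mulrBr mul1r mulr1 sk2.
- rewrite realZM sE -[t * t]expr2 scalerBr scalerA -rmorphM /=.
  rewrite mulfV ?scale1r ?subrKC //.
  by rewrite gt_eqF ?exprn_gt0.
Qed.

(** The element [t^2 - k^2] is [w^2] for the complement [w] of [k], and [circle_bound] applies to
    [w] by symmetry of the circle equation. *)
Lemma norm_circle_complement k t : 0 < t -> star k = k -> N k <= t ->
  N ((t ^+ 2)%:C *: 1 - k * k) <= t ^+ 2.
Proof.
move=> t0 sk kt; have [w [sw kw e]] := circle_complement t0 sk kt.
rewrite -e addrC addKr norm_sa_sqr // lerXn2r ?nnegrE ?norm_ge0 ?(ltW t0) //.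
by apply: (circle_bound (ltW t0) sw sk) => //; rewrite addrC.
Qed.

Lemma pos_sqr k : star k = k -> pos (k * k).
Proof.
move=> sk; pose t := N k + 1; have t0 : 0 < t by rewrite /t ltr_wpDl ?norm_ge0.
have kt : N k <= t by rewrite /t lerDl.
split; first by rewrite uc_starM sk.
by exists (t ^+ 2); [exact: sqr_ge0|exact: norm_circle_complement].
Qed.

(** Writing [p = k^2] gives [N p = N k ^ 2], so the difference is the square of the complement of
    [k] on the circle of radius [N k]. *)
Lemma pos_normB p : pos p -> pos ((N p)%:C *: 1 - p).
Proof.
case/pos_sqrt => k [sk _ <- _]; rewrite norm_sa_sqr //.
have [k0|k0] := eqVneq (N k) 0.
  by rewrite k0 (nrm0_eq0 nP k0) mulr0 subr0 expr0n scale0r; exact: pos0.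
have k1 : 0 < N k by rewrite lt_def k0 norm_ge0.
have [w [sw kw <-]] := circle_complement k1 sk (lexx _).
by rewrite addrC addKr; exact: pos_sqr.
Qed.

(** With [b = N (h + k)], both [h] and [b - h] are positive; their roots [m] and [v] commute and
    satisfy [m^2 + v^2 = b], so [circle_bound] gives [N m ^ 2 <= b]. *)
Lemma le_norm_posD h k : pos h -> pos k -> N h <= N (h + k).
Proof.
move=> ph pk; have pb := posD ph pk.
(* Positivity of [b - h] comes from adding [k] to [b - (h + k)]. *)
have := posD (pos_normB pb) pk; rewrite opprD addrA subrK.
have [m [sm _ mE _]] := pos_sqrt ph.
set v0 := _ - h => /pos_sqrt [v [sv _ vE vC]].
have B0 := norm_ge0 (h + k).
have : N m <= Num.sqrt (N (h + k)).
  apply: (circle_bound (sqrtr_ge0 _) sm sv).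
    apply/esym/vC; rewrite /v0 mulrBl mulrBr scalar_comm -mE.
    by rewrite mulrA.
  by rewrite mE vE /v0 subrKC sqr_sqrtr.
rewrite -(ler_pXn2r (n := 2)) ?nnegrE ?norm_ge0 ?sqrtr_ge0 //.
by rewrite sqr_sqrtr // -norm_sa_sqr // mE.
Qed.

(* With [p = e e^*] and [q = g^2 = - e^* e], the exchange rule
   [e (t - q) = (t + p) e] for [t = N e ^ 2] bounds [N ((t + p)^2 p)] by [t^3],
   whereas it dominates [2 t p^2], of norm [2 t^3]. *)
Lemma neg_sqr_star_eq0 e g : star g = g -> star e * e = - (g * g) -> e = 0.
Proof.
move=> sg eE; apply: (nrm0_eq0 nP); apply/eqP/negPn/negP => Ne0.
pose p := e * star e; pose t := N e ^+ 2.
have e0 : 0 < N e by rewrite lt_def Ne0 norm_ge0.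
have t0 : 0 < t by rewrite exprn_gt0.
have sp : star p = p by rewrite uc_starM uc_starK.
have Np : N p = t by rewrite /t -(norm_star e) -uc_normC uc_starK.
have pp : pos p.
  (* Cartesian decomposition [e = x + i y]: since [e e^* + e^* e = 2 (x^2 + y^2)] and
     [e^* e = - g^2], the element [p] is a sum of squares of self-adjoint elements. *)
  pose x := 2^-1%:C *: (e + star e); pose y := (2^-1%:C * 'i) *: (star e - e).
  have sx : star x = x by rewrite starZR uc_starD uc_starK addrC.
  have sy : star y = y.
    rewrite uc_starZ starB uc_starK rmorphM /= conj_real conjCi mulrN scaleNr.
    by rewrite -scalerN opprB.
  have xy : p = 2%:C *: (x * x + y * y) + g * g.
    have -> : g * g = - (star e * e) by rewrite eE opprK.
    rewrite realZM -scalerAl -scalerAr scalerA mulrACA.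
    rewrite -['i * _]expr2 sqrCi mulrN1 -rmorphM /=.
    rewrite scaleNr -scalerBr.
    have -> : (e + star e) * (e + star e) - (star e - e) * (star e - e)
        = 2%:C *: (e * star e + star e * e).
      rewrite rmorphD /= scalerDl scale1r.
      move: (star e) => f.
      have -> : (e + f) * (e + f) = e * e + e * f + (f * e + f * f).
        by rewrite mulrDl !mulrDr.
      have -> : (f - e) * (f - e) = f * f - f * e - (e * f - e * e).
        by rewrite mulrBl !mulrBr.
      rewrite !opprB addrACA [e * e + _]addrC -[e * f + e * e + _]addrA subrKC.
      by rewrite -[f * e + f * f + _]addrA subrKC addrACA.
    rewrite !scalerA -!rmorphM /=.
    have -> : 2 * (2^-1 * 2^-1) * 2 = 1 :> R by field.
    by rewrite scale1r addrK.
  rewrite xy; apply: posD; last exact: pos_sqr.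
  by apply: posZ => //; apply: posD; exact: pos_sqr.
have Ng : N g = N e.
  apply/eqP; rewrite -(eqrXn2 (n := 2)) ?norm_ge0 //.
  by rewrite -norm_sa_sqr // -(nrmN nP) -eE uc_normC.
have tq : N (t%:C *: 1 - g * g) <= t.
  by apply: norm_circle_complement => //; rewrite Ng.
pose z := t%:C *: 1 + p.
have ex : e * (t%:C *: 1 - g * g) = z * e.
  by rewrite -eE mulrDl mulrDr scalar_comm mulrA.
have Nze : N (z * e) ^+ 2 <= t ^+ 3.
  rewrite -ex; have a := uc_normM e (t%:C *: 1 - g * g).
  have -> : t ^+ 3 = (N e * t) ^+ 2 by rewrite exprMn -/t -exprS.
  rewrite lerXn2r ?nnegrE ?norm_ge0 ?mulr_ge0 ?norm_ge0 ?(ltW t0) //.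
  by apply: le_trans a _; rewrite ler_wpM2l // norm_ge0.
have zpz : N (z * e) ^+ 2 = N (z * p * z).
  rewrite -norm_star -uc_normC uc_starK uc_starM /p.
  by rewrite uc_starD starZR star1 sp !mulrA.
have zE : z * p * z = (2 * t)%:C *: (p * p) + ((t ^+ 2)%:C *: p + p * p * p).
  rewrite mulrDl -scalerAl mul1r mulrDr -scalerAr mulr1 mulrDl -scalerAl.
  rewrite scalerDr scalerA -rmorphM /= -expr2.
  rewrite -addrA [t%:C *: _ + (_ + _)]addrA -scalerDl -rmorphD /=.
  by rewrite addrCA mulr_natl mulr2n.
have pr : pos ((t ^+ 2)%:C *: p + p * p * p).
  apply: posD; first by apply: posZ; rewrite ?sqr_ge0.
  have [m [sm _ mE mC]] := pos_sqrt pp.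
  have pm : m * p = p * m by exact: mC.
  have -> : p * p * p = (p * m) * (p * m).
    by rewrite -(mulrA p m) (mulrA m p) pm -(mulrA p m) mE mulrA.
  by apply: pos_sqr; rewrite uc_starM sp sm.
have t2 : 0 <= 2 * t by lra.
have pq : pos ((2 * t)%:C *: (p * p)).
  by apply: posZ => //; exact: pos_sqr.
have := le_norm_posD pq pr; rewrite -zE -zpz (nrmZR nP _ t2).
rewrite norm_sa_sqr // Np => a; have := le_trans a Nze.
have : 0 < t ^+ 3 by rewrite exprn_gt0.
by rewrite exprS; nra.
Qed.

(** Let [r] be the absolute value of [h = c^* c], and [d = r - h], twice the negative part of [h].
    From [h d = - r d] one gets [(c d)^* (c d) = - r d^2], so [c d = 0] by [neg_sqr_star_eq0]. Then
    [h d = r d = 0], hence [d^2 = 0] and [h = r] is positive. *)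
Lemma pos_star c : pos (star c * c).
Proof.
set h := star c * c.
have sh : star h = h by rewrite uc_starM uc_starK.
have [r [sr pr rE rC]] := pos_sqrt (pos_sqr sh).
(* The root of [r] turns [r d^2] into the square of the self-adjoint element [q d]. *)
have [q [sq _ qE qC]] := pos_sqrt pr.
have rh : r * h = h * r by apply: rC; rewrite mulrA.
have qh : q * h = h * q by apply: qC.
have qr : q * r = r * q by rewrite -qE mulrA.
pose d := r - h.
have sd : star d = d by rewrite starB sr sh.
have hd : h * d = - (r * d).
  by rewrite !mulrBr rE -rh opprB.
have qd : q * d = d * q by rewrite mulrBl mulrBr qr qh.
have e0 : c * d = 0.
  apply: (@neg_sqr_star_eq0 _ (q * d)).
    by rewrite uc_starM sq sd.
  have -> : star (c * d) * (c * d) = d * (h * d).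
    by rewrite uc_starM sd /h !mulrA.
  have -> : q * d * (q * d) = r * d * d.
    by rewrite -(mulrA q d) (mulrA d q) -qd -(mulrA q d) (mulrA q q) qE mulrA.
  have rd : r * d = d * r by rewrite mulrBl mulrBr rh.
  by rewrite hd mulrN {2}rd mulrA.
have hd0 : h * d = 0 by rewrite /h -mulrA e0 mulr0.
have dd : d * d = 0 by rewrite {1}/d mulrBl -[r * d]opprK -hd hd0 oppr0 addr0.
have -> : h = r.
  apply/esym/subr0_eq/(nrm0_eq0 nP)/eqP; rewrite -/d -sqrf_eq0.
  by rewrite -norm_sa_sqr // dd (nrm0 nP).
exact: pr.
Qed.

End UnitalCstar.

(** * Unitization *)

Section RealComplete.
Variable R : realType.

Lemma real_cauchy_tends (u : nat -> R) :
  (forall e, 0 < e -> exists N, forall m n, (N <= m)%N -> (N <= n)%N ->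
     `|u m - u n| < e) ->
  exists l, forall e, 0 < e -> exists N, forall n, (N <= n)%N -> `|u n - l| < e.
Proof.
(* [E] collects the eventual lower bounds of [u], so its supremum is the lower limit. *)
move=> cu; pose E := [set x | exists N, forall n, (N <= n)%N -> x <= u n]%classic.
have near e : 0 < e -> exists N, forall n, (N <= n)%N ->
    E (u n - e) /\ ubound E (u n + e).
  move=> e0; have [N hN] := cu e e0; exists N => n Nn; split.
    by exists N => m Nm; have := hN _ _ Nn Nm; rewrite ltr_norml; lra.
  move=> x [M hM]; have := hM _ (leq_maxr N M).
  by have := hN _ _ Nn (leq_maxl N M); rewrite ltr_norml; lra.
have hE : has_sup E.
  have [N hN] := near 1 ltr01; have [a b] := hN N (leqnn N).
  by split; [exists (u N - 1)|exists (u N + 1)].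
exists (sup E) => e e0; have e20 : 0 < e / 2 by lra.
have [N hN] := near _ e20; exists N => n /hN[a b].
have := sup_upper_bound hE a; have := ge_sup (proj1 hE) b.
by rewrite ltr_norml; lra.
Qed.

Lemma normr_Re_le_cabs (c : R[i]) : `|complex.Re c| <= cabs c.
Proof. by rewrite -lecR -cabsE normc_ge_Re. Qed.

Lemma normr_Im_le_cabs (c : R[i]) : `|complex.Im c| <= cabs c.
Proof.
case: c => a b; rewrite /cabs /= -sqrtr_sqr ler_sqrt ?lerDr ?sqr_ge0 //.
by rewrite addr_ge0 ?sqr_ge0.
Qed.

Lemma cabs_le_ReIm (c : R[i]) : cabs c <= `|complex.Re c| + `|complex.Im c|.
Proof.
rewrite {1}(complexE c); apply: le_trans (cabsD _ _) _.
rewrite cabsM cabsi mul1r.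
suff H (r : R) : cabs r%:C = `|r| by rewrite !H.
by apply: (@complexI R); rewrite -cabsE normc_def /= expr0n addr0 sqrtr_sqr.
Qed.

Lemma complex_cauchy_tends (u : nat -> R[i]) :
  (forall e, 0 < e -> exists N, forall m n, (N <= m)%N -> (N <= n)%N ->
     cabs (u m - u n) < e) ->
  exists l, forall e, 0 < e -> exists N, forall n, (N <= n)%N ->
    cabs (u n - l) < e.
Proof.
move=> cu.
have [a ha] : exists l, forall e, 0 < e -> exists N, forall n, (N <= n)%N ->
    `|complex.Re (u n) - l| < e.
  apply: real_cauchy_tends => e /cu[N hN]; exists N => m n Nm Nn.
  apply: le_lt_trans (hN _ _ Nm Nn); rewrite -raddfB.
  exact: normr_Re_le_cabs.
have [b hb] : exists l, forall e, 0 < e -> exists N, forall n, (N <= n)%N ->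
    `|complex.Im (u n) - l| < e.
  apply: real_cauchy_tends => e /cu[N hN]; exists N => m n Nm Nn.
  apply: le_lt_trans (hN _ _ Nm Nn); rewrite -raddfB.
  exact: normr_Im_le_cabs.
exists (a +i* b) => e e0; have e20 : 0 < e / 2 by lra.
have [N1 h1] := ha _ e20; have [N2 h2] := hb _ e20.
exists (maxn N1 N2) => n; rewrite geq_max => /andP[/h1 x1 /h2 x2].
apply: le_lt_trans (cabs_le_ReIm _) _; rewrite !raddfB /=.
by rewrite (splitr e) ltrD.
Qed.

End RealComplete.

(** The pair [(l, a)] stands for [l + a]; the separate name carries the ring structure defined
    below. *)
Definition unitz (R : realType) (A : CstarAlg R) : Type := (R[i]^o * A)%type.

Section Unitization.
Variables (R : realType) (A : CstarAlg R).
Local Notation UA := (unitz A).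
Local Notation na := (@ca_norm R A).
Local Notation naP := (@ca_normP R A).
Implicit Types (a b c : A) (x y z : UA).

HB.instance Definition _ := GRing.Lmodule.on UA.

Lemma ca_mul0r a : ca_mul 0 a = 0.
Proof. by rewrite -{1}(scale0r (0 : A)) ca_mulZl scale0r. Qed.

Lemma ca_mulr0 a : ca_mul a 0 = 0.
Proof. by rewrite -{1}(scale0r (0 : A)) ca_mulZr scale0r. Qed.

Lemma ca_norm_star a : na (ca_star a) = na a.
Proof.
suff le b : na b <= na (ca_star b).
  by apply/le_anti; rewrite -{2}(ca_starK a) !le.
have := ca_normM (ca_star b) b; rewrite ca_normC expr2.
have [->|y0] := eqVneq (na b) 0; first by rewrite nrm_ge0 //; exact: naP.
by rewrite ler_pM2r // lt_def y0 nrm_ge0 //; exact: naP.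
Qed.

Definition umul x y : UA :=
  (x.1 * y.1 : R[i]^o, x.1 *: y.2 + y.1 *: x.2 + ca_mul x.2 y.2).
Definition uone : UA := (1 : R[i]^o, 0).
Definition ustar x : UA := (Num.conj x.1 : R[i]^o, ca_star x.2).
(** Left multiplication by [l + a] on the ideal [A], from which the norm is defined. *)
Definition uact x b : A := x.1 *: b + ca_mul x.2 b.

Lemma umulA : associative umul.
Proof.
move=> [l a] [m b] [n c]; congr pair => /=; first exact: mulrA.
rewrite !(ca_mulDl, ca_mulDr, ca_mulZl, ca_mulZr, scalerDr, scalerA) ca_mulA.
rewrite !addrA; congr (_ + _).
rewrite (mulrC n l) (mulrC n m).
by rewrite -!addrA; do 2!congr (_ + _); rewrite [LHS]addrCA; congr (_ + _);
  rewrite addrA addrC.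
Qed.

Lemma umul1r : left_id uone umul.
Proof.
by case=> l a; rewrite /umul /= mul1r scale1r scaler0 ca_mul0r !addr0.
Qed.

Lemma umulr1 : right_id uone umul.
Proof.
by case=> l a; rewrite /umul /= mulr1 scale1r scaler0 ca_mulr0 addr0 add0r.
Qed.

Lemma umulDl : left_distributive umul +%R.
Proof.
move=> [l a] [m b] [n c]; congr pair => /=; first exact: mulrDl.
rewrite scalerDl scalerDr ca_mulDl [RHS]addrACA; congr (_ + _).
by rewrite addrACA.
Qed.

Lemma umulDr : right_distributive umul +%R.
Proof.
move=> [l a] [m b] [n c]; congr pair => /=; first exact: mulrDr.
rewrite scalerDl scalerDr ca_mulDr [RHS]addrACA; congr (_ + _).
by rewrite addrACA.
Qed.

Lemma uone_neq0 : uone != 0.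
Proof. by apply/eqP => -[/eqP]; rewrite oner_eq0. Qed.

HB.instance Definition _ := GRing.Zmodule_isNzRing.Build UA
  umulA umul1r umulr1 umulDl umulDr uone_neq0.

Lemma uscalerAl (k : R[i]) x y : k *: (x * y) = k *: x * y.
Proof.
case: x y => [l a] [m b]; congr pair => /=; first exact: mulrA.
by rewrite !scalerDr ca_mulZl !scalerA (mulrC k m).
Qed.

HB.instance Definition _ := GRing.Lmodule_isLalgebra.Build R[i] UA uscalerAl.

Lemma uscalerAr (k : R[i]) x y : k *: (x * y) = x * (k *: y).
Proof.
case: x y => [l a] [m b]; congr pair => /=; first exact: mulrCA.
by rewrite !scalerDr ca_mulZr !scalerA (mulrC k l).
Qed.

HB.instance Definition _ := GRing.Lalgebra_isAlgebra.Build R[i] UA uscalerAr.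

Lemma ustarD x y : ustar (x + y) = ustar x + ustar y.
Proof. by congr pair => /=; [rewrite rmorphD|rewrite ca_starD]. Qed.

Lemma ustarZ (l : R[i]) x : ustar (l *: x) = Num.conj l *: ustar x.
Proof. by congr pair => /=; [rewrite rmorphM|rewrite ca_starZ]. Qed.

Lemma ustarK x : ustar (ustar x) = x.
Proof. by case: x => l a; rewrite /ustar /= conjCK ca_starK. Qed.

Lemma ustarM x y : ustar (x * y) = ustar y * ustar x.
Proof.
case: x y => [l a] [m b]; congr pair => /=; first by rewrite rmorphM mulrC.
by rewrite !ca_starD !ca_starZ ca_starM [in LHS](addrC (_ *: ca_star b)).
Qed.

Lemma uactD x y b : uact (x + y) b = uact x b + uact y b.
Proof. by rewrite /uact scalerDl ca_mulDl addrACA. Qed.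

Lemma uactZ (k : R[i]) x b : uact (k *: x) b = k *: uact x b.
Proof. by rewrite /uact scalerDr scalerA ca_mulZl. Qed.

Lemma uactM x y b : uact (x * y) b = uact x (uact y b).
Proof.
case: x y => [l a] [m c]; rewrite /uact /=.
rewrite !(ca_mulDl, ca_mulDr, ca_mulZl, ca_mulZr, scalerDr, scalerA) ca_mulA.
by rewrite !addrA.
Qed.

(** Adjunction for the [A]-valued form [b^* c], the source of the C*-identity for [unorm]. *)
Lemma uact_adj x b c :
  ca_mul (ca_star (uact x b)) c = ca_mul (ca_star b) (uact (ustar x) c).
Proof.
rewrite /uact /= ca_starD ca_starZ ca_starM ca_mulDl ca_mulDr ca_mulZl ca_mulZr.
by rewrite ca_mulA.
Qed.

Definition mult_bound x (M : R) :=
  cabs x.1 <= M /\ forall b, na (uact x b) <= M * na b.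

(* The infimum runs over common bounds of the scalar part and of left
   multiplication, so that the result is a norm even if [A] is unital. *)
Definition unorm x : R := inf [set M | mult_bound x M]%classic.

Lemma na_ge0 b : 0 <= na b. Proof. exact: nrm_ge0 naP b. Qed.

Lemma mult_bound_sum x : mult_bound x (cabs x.1 + na x.2).
Proof.
split=> [|b]; first by rewrite lerDl na_ge0.
apply: le_trans (nrmD naP _ _) _; rewrite (nrmZ naP) mulrDl lerD2l.
exact: ca_normM.
Qed.

Lemma unorm_le x M : mult_bound x M -> unorm x <= M.
Proof.
by move=> h; apply: ge_inf => //; exists (cabs x.1) => m [].
Qed.

Lemma unormP x : mult_bound x (unorm x).
Proof.
have ne : ([set M | mult_bound x M] !=set0)%classic.
  by exists (cabs x.1 + na x.2); exact: mult_bound_sum.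
split=> [|b]; first by apply: lb_le_inf => // M [].
have [b0|b0] := eqVneq (na b) 0.
  by rewrite b0 mulr0; have [_ /(_ b)] := mult_bound_sum x; rewrite b0 mulr0.
have b1 : 0 < na b by rewrite lt_def b0 na_ge0.
rewrite -ler_pdivrMr //; apply: lb_le_inf => // M [_ /(_ b)].
by rewrite ler_pdivrMr.
Qed.

Lemma unorm_ge0 x : 0 <= unorm x.
Proof. by case: (unormP x) => h _; apply: le_trans h; exact: cabs_ge0. Qed.

Lemma na_mul_star a : na (ca_mul a (ca_star a)) = na a ^+ 2.
Proof. by rewrite -{1}(ca_starK a) ca_normC ca_norm_star. Qed.

(** Test the action on [a^*]: removing the scalar part leaves [a a^*], of norm [||a||^2], so
    [||a||^2 <= 2 * unorm x * ||a||]. This yields definiteness and completeness of [unorm]. *)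
Lemma na_le_unorm x : na x.2 <= 2 * unorm x.
Proof.
have [a0|a0] := eqVneq (na x.2) 0; first by rewrite a0 mulr_ge0 // unorm_ge0.
have a1 : 0 < na x.2 by rewrite lt_def a0 na_ge0.
have [h1 /(_ (ca_star x.2))] := unormP x; rewrite ca_norm_star => h2.
have e : ca_mul x.2 (ca_star x.2)
    = uact x (ca_star x.2) - x.1 *: ca_star x.2 by rewrite addrC addKr.
have := na_mul_star x.2; rewrite e => h3.
have := nrmB naP (uact x (ca_star x.2)) (x.1 *: ca_star x.2).
rewrite (nrmZ naP) ca_norm_star h3; nra.
Qed.

Lemma unormM x y : unorm (x * y) <= unorm x * unorm y.
Proof.
have [x1 x2] := unormP x; have [y1 y2] := unormP y.
apply: unorm_le; split=> [|b].
  by rewrite cabsM ler_pM // cabs_ge0.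
rewrite uactM; apply: le_trans (x2 _) _; rewrite -mulrA.
by rewrite ler_wpM2l ?unorm_ge0.
Qed.

(** By the adjunction, [||x b||^2] is the norm of [b^* (x^* x b)], hence at most
    [unorm (x^* x) ||b||^2]; the scalar parts satisfy the same bound. *)
Lemma unorm_sqr_le x : unorm x ^+ 2 <= unorm (ustar x * x).
Proof.
have [x1 x2] := unormP (ustar x * x).
have M0 := unorm_ge0 (ustar x * x).
suff H : unorm x <= Num.sqrt (unorm (ustar x * x)).
  rewrite -[leRHS]sqr_sqrtr // lerXn2r ?nnegrE ?sqrtr_ge0 ?unorm_ge0 //.
apply: unorm_le; split=> [|b].
  rewrite -[leLHS]ger0_norm ?cabs_ge0 // -sqrtr_sqr ler_sqrt //.
  by move: x1; rewrite cabsM cabsJ -expr2.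
rewrite -(ler_pXn2r (n := 2)) ?nnegrE ?mulr_ge0 ?na_ge0 ?sqrtr_ge0 //.
rewrite exprMn sqr_sqrtr // -ca_normC uact_adj -uactM.
apply: le_trans (ca_normM _ _) _; rewrite ca_norm_star.
have := x2 b; have := na_ge0 b; nra.
Qed.

Lemma unorm_star x : unorm (ustar x) = unorm x.
Proof.
suff le y : unorm y <= unorm (ustar y).
  by apply/le_anti; rewrite -{2}(ustarK x) !le.
have := le_trans (unorm_sqr_le y) (unormM _ _); rewrite expr2.
have [->|y0] := eqVneq (unorm y) 0; first by rewrite unorm_ge0.
by rewrite ler_pM2r // lt_def y0 unorm_ge0.
Qed.

Lemma unormC x : unorm (ustar x * x) = unorm x ^+ 2.
Proof.
apply/le_anti; rewrite unorm_sqr_le andbT.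
by apply: le_trans (unormM _ _) _; rewrite unorm_star expr2.
Qed.

Lemma unorm_is_norm : is_norm unorm.
Proof.
have leZ (c : R[i]) x : unorm (c *: x) <= cabs c * unorm x.
  have [x1 x2] := unormP x.
  apply: unorm_le; split=> [|b]; first by rewrite cabsM ler_wpM2l ?cabs_ge0.
  by rewrite uactZ (nrmZ naP) -mulrA ler_wpM2l ?cabs_ge0.
split.
- exact: unorm_ge0.
- move=> [l a] x0; have [x1 x2] := unormP (l, a).
  congr pair.
    apply: ComplexField.Normc.eq0_normc; apply/le_anti.
    by rewrite cabs_ge0 andbT -x0.
  apply: (nrm0_eq0 naP); apply/le_anti; rewrite na_ge0 andbT.
  by have := na_le_unorm (l, a); rewrite x0 mulr0.
- move=> x y; have [x1 x2] := unormP x; have [y1 y2] := unormP y.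
  apply: unorm_le; split=> [|b].
    by apply: le_trans (cabsD _ _) _; exact: lerD.
  by rewrite uactD mulrDl; apply: le_trans (nrmD naP _ _) _; exact: lerD.
- move=> c x; apply/le_anti; rewrite leZ /=.
  have [->|c0] := eqVneq c 0.
    by rewrite /cabs ComplexField.Normc.normc0 mul0r unorm_ge0.
  have cc0 : 0 < cabs c.
    rewrite lt_def cabs_ge0 andbT; apply: contra c0.
    by move=> /eqP/ComplexField.Normc.eq0_normc ->.
  have := leZ c^-1 (c *: x); rewrite scalerA mulVf // scale1r.
  have -> : cabs c^-1 = (cabs c)^-1 by exact: ComplexField.Normc.normcV.
  by rewrite ler_pdivlMl.
Qed.

(** Both component norms are bounded by multiples of [unorm], and [unorm] by their sum, so limits
    are taken componentwise. *)
Lemma unorm_complete : complete_for unorm.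
Proof.
move=> u cu.
have [l hl] : exists l, forall e, 0 < e -> exists N, forall n, (N <= n)%N ->
    cabs ((u n).1 - l) < e.
  apply: complex_cauchy_tends => e /cu[N hN]; exists N => m n Nm Nn.
  by apply: le_lt_trans (hN _ _ Nm Nn); case: (unormP (u m - u n)).
have [a ha] : exists a, tends na (fun n => (u n).2) a.
  apply: ca_complete => e e0; have e20 : 0 < e / 2 by lra.
  have [N hN] := cu _ e20; exists N => m n Nm Nn.
  have := hN _ _ Nm Nn; have := na_le_unorm (u m - u n).
  rewrite -[(u m - u n).2]/((u m).2 - (u n).2); lra.
exists (l, a) => e e0; have e20 : 0 < e / 2 by lra.
have [N1 h1] := hl _ e20; have [N2 h2] := ha _ e20.
exists (maxn N1 N2) => n; rewrite geq_max => /andP[/h1 x1 /h2 x2].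
apply: le_lt_trans (unorm_le (mult_bound_sum _)) _.
by rewrite (splitr e) ltrD.
Qed.

Definition unitization : ucstar R :=
  Build_ucstar ustarD ustarZ ustarK ustarM unorm_is_norm unormM unormC
    unorm_complete.

Definition uemb a : unitization := (0 : R[i]^o, a).

Lemma uembD a b : uemb (a + b) = uemb a + uemb b.
Proof. by congr pair; rewrite /= addr0. Qed.

Lemma uembN a : uemb (- a) = - uemb a.
Proof. by congr pair; rewrite /= oppr0. Qed.

Lemma uembZ (k : R[i]) a : uemb (k *: a) = k *: uemb a.
Proof. by congr pair; rewrite /= scaler0. Qed.

Lemma uembM a b : uemb (ca_mul a b) = uemb a * uemb b.
Proof. by congr pair; rewrite /= ?mul0r // !scale0r !add0r. Qed.

Lemma uemb_star a : uemb (ca_star a) = uc_star (uemb a).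
Proof. by congr pair; rewrite /= rmorph0. Qed.

(** The lower bound tests the action of [a] on [a^*]. *)
Lemma uemb_norm a : uc_norm (uemb a) = na a.
Proof.
apply/le_anti/andP; split.
  apply: le_trans (unorm_le (mult_bound_sum _)) _.
  by rewrite /cabs ComplexField.Normc.normc0 add0r.
have [a0|a0] := eqVneq (na a) 0; first by rewrite a0 unorm_ge0.
have a1 : 0 < na a by rewrite lt_def a0 na_ge0.
have [_ /(_ (ca_star a))] := unormP (uemb a).
by rewrite /uact scale0r add0r na_mul_star ca_norm_star expr2 ler_pM2r.
Qed.

End Unitization.

(** * Cauchy-Schwarz inequality in Hilbert modules *)

Section CauchySchwarz.
Variables (R : realType) (A : CstarAlg R) (X : HilbMod A).
Local Notation na := (@ca_norm R A).
Local Notation naP := (@ca_normP R A).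
Local Notation ip := (@hm_ip R A X).
Local Notation "a ** b" := (ca_mul a b) (at level 40, left associativity).
Implicit Types (x y z : X) (a : A).

Lemma ca_starB a (b : A) : ca_star (a - b) = ca_star a - ca_star b.
Proof. by rewrite ca_starD -scaleN1r ca_starZ rmorphN1 scaleN1r. Qed.

Lemma hm_ipDr x y z : ip x (y + z) = ip x y + ip x z.
Proof. by rewrite -(hm_ipC (y + z)) hm_ipDl ca_starD !hm_ipC. Qed.

Lemma hm_ipZr (l : R[i]) x y : ip x (l *: y) = Num.conj l *: ip x y.
Proof. by rewrite -(hm_ipC (l *: y)) hm_ipZl ca_starZ hm_ipC. Qed.

Lemma hm_ipBl x y z : ip (x - y) z = ip x z - ip y z.
Proof. by rewrite hm_ipDl -scaleN1r hm_ipZl scaleN1r. Qed.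

(** Kaplansky's theorem enters here: positivity of the form [b^* b] becomes membership in the cone
    [pos]. *)
Lemma pos_uemb_ip x : pos (uemb (ip x x)).
Proof.
by have [b ->] := hm_ip_pos x; rewrite uembM uemb_star; exact: pos_star.
Qed.

(* Positivity of [<z,z>] for [z = <y,x> x - T y] with [T = ||<x,x>||]. *)
Lemma ip_norm_sqr_le x y : na (ip x y) ^+ 2 <= na (ip x x) * na (ip y y).
Proof.
have [T0|T0] := eqVneq (na (ip x x)) 0.
  have -> : x = 0 by exact: hm_ip_def (nrm0_eq0 naP T0).
  by rewrite -(scale0r y) !hm_ipZl !scale0r (nrm0 naP) expr0n mul0r.
set T := na (ip x x) in T0 *.
have T1 : 0 < T by rewrite lt_def T0 (nrm_ge0 naP).
pose c := uemb (ip x y); pose p := uemb (ip x x); pose q := uemb (ip y y).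
have Np : uc_norm p = T by rewrite uemb_norm.
have pp : pos p by exact: pos_uemb_ip.
have sc : uemb (ip y x) = uc_star c by rewrite -uemb_star hm_ipC.
pose z := hm_act (ip y x) x - T%:C *: y.
have pz : pos (uemb (ip z z)) by exact: pos_uemb_ip.
have zl w : ip z w = ip y x ** ip x w - T%:C *: ip y w.
  by rewrite hm_ipBl hm_ipA hm_ipZl.
have zz : uemb (ip z z)
    = uc_star c * (p * c - T%:C *: c) - T%:C *: (uc_star c * c - T%:C *: q).
  rewrite zl -(hm_ipC z x) -(hm_ipC z y) !zl !ca_starB !ca_starM !ca_starZ.
  rewrite !hm_ipC conj_real.
  by rewrite !(uembD, uembN, uembM, uembZ) sc.
have [w [sw _ wE _]] := pos_sqrt (pos_normB pp); rewrite Np in wE.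
have pw : pos (uc_star c * (w * w) * c).
  have -> : uc_star c * (w * w) * c = uc_star (w * c) * (w * c).
    by rewrite uc_starM sw !mulrA.
  exact: pos_star.
(* Solving the formula for [<z,z>] for [T^2 <y,y>] shows that it exceeds [T c^* c] by a positive
   element, the part [c^* (T - p) c] being [c^* w^2 c]. Monotonicity of the norm then concludes. *)
have qE : (T * T)%:C *: q = T%:C *: (uc_star c * c)
    + (uc_star c * (w * w) * c + uemb (ip z z)).
  rewrite zz wE mulrBr mulrBl mulrBr -!scalerAr mulr1 -scalerAl scalerBr.
  rewrite scalerA -rmorphM /= mulrA opprB.
  by rewrite [X in _ + X]addrA subrKA subrr add0r subrKC.
have := le_norm_posD (posZ (ltW T1) (pos_star c)) (posD pw pz).
rewrite -qE !(nrmZR (@uc_normP _ _)) ?mulr_ge0 ?(ltW T1) //.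
by rewrite uc_normC !uemb_norm -mulrA ler_pM2l.
Qed.

Lemma hnorm_sqr x : hnorm x ^+ 2 = na (ip x x).
Proof. by rewrite sqr_sqrtr // (nrm_ge0 naP). Qed.

Lemma ip_norm_le x y : na (ip x y) <= hnorm x * hnorm y.
Proof.
rewrite -(ler_pXn2r (n := 2)) ?nnegrE ?mulr_ge0 ?sqrtr_ge0 ?(nrm_ge0 naP) //.
by rewrite exprMn !hnorm_sqr ip_norm_sqr_le.
Qed.

Lemma hnorm_is_norm : is_norm (@hnorm R A X).
Proof.
split.
- by move=> x; exact: sqrtr_ge0.
- move=> x x0; apply/hm_ip_def/(nrm0_eq0 naP).
  by rewrite -hnorm_sqr x0 expr0n.
- move=> x y; rewrite -(ler_pXn2r (n := 2)) ?nnegrE ?addr_ge0 ?sqrtr_ge0 //.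
  rewrite hnorm_sqr hm_ipDl !hm_ipDr.
  have h1 := nrmD naP (ip x x + ip x y) (ip y x + ip y y).
  have h2 := nrmD naP (ip x x) (ip x y); have h3 := nrmD naP (ip y x) (ip y y).
  have h4 := ip_norm_le x y; have h5 := ip_norm_le y x.
  by move: h1 h2 h3 h4 h5; rewrite -!hnorm_sqr; nra.
- move=> c x; rewrite /hnorm hm_ipZl hm_ipZr !(nrmZ naP) cabsJ mulrA -expr2.
  by rewrite sqrtrM ?sqr_ge0 // sqrtr_sqr ger0_norm // cabs_ge0.
Qed.

(** Submultiplicativity applied to [<ax,ax> = a <x,x> a^*]. *)
Lemma hnorm_act_le a x : hnorm (hm_act a x) <= na a * hnorm x.
Proof.
rewrite -(ler_pXn2r (n := 2)) ?nnegrE ?mulr_ge0 ?sqrtr_ge0 ?(nrm_ge0 naP) //.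
rewrite exprMn !hnorm_sqr hm_ipA -(hm_ipC (hm_act a x)) hm_ipA.
rewrite ca_starM hm_ipC.
have := ca_normM a (ip x x ** ca_star a); have := ca_normM (ip x x) (ca_star a).
rewrite ca_norm_star; have := nrm_ge0 naP a; have := nrm_ge0 naP (ip x x).
by nra.
Qed.

End CauchySchwarz.

(** * Stability *)

Section NullSequences.
Variable R : realType.

Definition null (d : nat -> R) :=
  forall e, 0 < e -> exists N, forall n, (N <= n)%N -> d n < e.

Lemma null_expr (q : R) : 0 <= q -> q < 1 -> null (fun n => q ^+ n).
Proof.
move=> q0 q1 e e0.
(* Bernoulli's inequality in the form [q^n <= 1 / (1 + n (1 - q))], so any [n] with
   [n (1 - q) e > 1] will do. *)
have B n : q ^+ n * (1 + n%:R * (1 - q)) <= 1.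
  elim: n => [|n IH]; first by rewrite expr0 mul0r addr0 mul1r.
  apply: le_trans IH; rewrite exprSr -mulrA ler_wpM2l ?exprn_ge0 // -natr1.
  have := mulr_ge0 (ler0n R n.+1) (sqr_ge0 (1 - q)).
  by rewrite -natr1 expr2; nra.
have d0 : 0 < e * (1 - q) by rewrite mulr_gt0 // subr_gt0.
have h := archi_boundP (ltW (divr_gt0 ltr01 d0)).
exists (Num.bound (1 / (e * (1 - q)))) => n Nn.
rewrite ltr_pdivrMr // in h.
have Nn' : (Num.bound (1 / (e * (1 - q))))%:R <= n%:R :> R by rewrite ler_nat.
have := B n; have := exprn_ge0 n q0; rewrite ltNge; move: h Nn' => h Nn' p0 b.
apply/negP => le_e.
have : 1 < n%:R * (e * (1 - q)) by apply: lt_le_trans h _; rewrite ler_wpM2r // ltW.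
have n0 : 0 <= n%:R * (1 - q) by rewrite mulr_ge0 // subr_ge0 ltW.
by nra.
Qed.

Lemma nullMl (K : R) d : 0 <= K -> null d -> null (fun n => K * d n).
Proof.
move=> K0 d0 e e0; have K1 : 0 < K + 1 by lra.
have [N h] := d0 _ (divr_gt0 e0 K1); exists N => n /h.
by rewrite ltr_pdivlMr //; nra.
Qed.

(** Turns an approximate identity between sequences into equality of limits; it serves for
    linearity, multiplicativity and uniqueness alike. *)
Lemma tends_eq (V : lmodType R[i]) (nrm : V -> R) (u v : nat -> V) x y d :
  is_norm nrm -> tends nrm u x -> tends nrm v y -> null d ->
  (forall n, nrm (u n - v n) <= d n) -> x = y.
Proof.
move=> nP ux vy d0 h; apply: (tends_uniq nP ux) => e e0.
have e20 : 0 < e / 2 by lra.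
have [N1 h1] := d0 _ e20; have [N2 h2] := vy _ e20.
exists (maxn N1 N2) => n; rewrite geq_max => /andP[/h1 a /h2 b].
apply: le_lt_trans (nrmB3 nP (v n) _ _) _; rewrite (splitr e) ltrD //.
exact: le_lt_trans (h n) a.
Qed.

(** Here [d n] plays the part of the remainder of a majorizing series, so that no infinite sum has
    to be formed. *)
Lemma telescoping_limit (V : lmodType R[i]) (nrm : V -> R) (u : nat -> V) d :
  is_norm nrm -> complete_for nrm -> (forall n, 0 <= d n) -> null d ->
  (forall n, nrm (u n - u n.+1) <= d n - d n.+1) ->
  exists2 l, tends nrm u l & nrm (u 0 - l) <= d 0%N.
Proof.
move=> nP nC dp d0 h.
have hm m k : nrm (u m - u (m + k)%N) <= d m - d (m + k)%N.
  elim: k => [|k IH]; first by rewrite addn0 !subrr (nrm0 nP).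
  rewrite addnS; apply: le_trans (nrmB3 nP (u (m + k)%N) _ _) _.
  by have := h (m + k)%N; lra.
have [l ul] : exists l, tends nrm u l.
  apply: nC => e e0; have [N hN] := d0 e e0; exists N => m n.
  wlog mn : m n / (m <= n)%N => [W Nm Nn|Nm _].
    by case/orP: (leq_total m n) => /W; last rewrite (nrmBC nP); apply.
  have := hm m (n - m)%N; rewrite subnKC //.
  by have := hN _ Nm; have := dp n; lra.
exists l => //; rewrite (nrmBC nP); apply: (tends_bound nP ul) => n.
by rewrite (nrmBC nP); have := hm 0 n; rewrite add0n; have := dp n; lra.
Qed.

End NullSequences.

(** * From unimodular scalars to complex linearity *)

Section UnimodularLinear.
Variables (R : realType) (X Y : lmodType R[i]) (H : X -> Y).
Hypothesis Hmu : forall (mu : R[i]) x y, cabs mu = 1 ->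
  H (mu *: x + y) = mu *: H x + H y.

(** The case [mu = 1] is additivity. Sums of two unimodular numbers and integer multiples then reach
    every real scalar, and the unimodular ['i] gives the imaginary part. *)
Lemma unimodular_linear (l : R[i]) x y : H (l *: x + y) = l *: H x + H y.
Proof.
have c1 : cabs (1 : R[i]) = 1 by exact: ComplexField.Normc.normc1.
have HD a b : H (a + b) = H a + H b by have := Hmu a b c1; rewrite !scale1r.
have H0 : H 0 = 0 by apply: (addrI (H 0)); rewrite -HD !addr0.
have HZ mu (m1 : cabs mu = 1) a : H (mu *: a) = mu *: H a.
  by rewrite -[mu *: a]addr0 Hmu // H0 addr0.
have Hn a n : H (a *+ n) = H a *+ n.
  by elim: n => [|n IH]; rewrite ?mulr0n // !mulrS HD IH.
(* A real number in [-1, 1] is the mean of two conjugate unimodular ones. *)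
have Hs (r : R) a : -1 <= r <= 1 -> H ((r + r)%:C *: a) = (r + r)%:C *: H a.
  move=> r1; pose s := Num.sqrt (1 - r ^+ 2).
  have s2 : s ^+ 2 = 1 - r ^+ 2 by rewrite sqr_sqrtr //; nra.
  have e : (r + r)%:C = (r +i* s) + (r +i* (- s)) :> R[i].
    by apply/eqP; rewrite eq_complex /= subrr !eqxx.
  have m1 : cabs (r +i* s) = 1.
    by rewrite /cabs /= s2 subrKC sqrtr1.
  have m2 : cabs (r +i* (- s)) = 1.
    by rewrite /cabs /= sqrrN s2 subrKC sqrtr1.
  by rewrite e !scalerDl HD !HZ.
have Hr (r : R) a : H (r%:C *: a) = r%:C *: H a.
  have h := archi_boundP (normr_ge0 r).
  set n := Num.bound _ in h.
  have n0 : 0 < n%:R :> R by apply: le_lt_trans h.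
  have nC : n%:R = (n%:R : R)%:C by rewrite rmorph_nat.
  (* [Hs] treats the scalar [q + q], hence the factor 2; dividing by [n > |r|] brings [q] into
     [[-1, 1]]. *)
  pose q := r / n%:R / 2.
  have qE : r = (q + q) * n%:R.
    by rewrite /q -splitr divfK // gt_eqF.
  have q1 : -1 <= q <= 1.
    move: h; rewrite ltr_norml {1 2}qE; nra.
  rewrite qE rmorphM /= -scalerA -nC scaler_nat Hs // Hn.
  by rewrite -scaler_nat scalerA nC.
rewrite HD (complexE l) !scalerDl HD -!scalerA (HZ 'i (cabsi R)).
by rewrite !Hr.
Qed.

End UnimodularLinear.

(** * Dyadic rescaling and the stability theorem *)

Lemma cabs_pow2 (R : realType) n : cabs ((2 : R[i]) ^+ n) = 2 ^+ n.
Proof.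
have -> : (2 : R[i]) ^+ n = (2 ^+ n)%:C by rewrite rmorphXn /= rmorph_nat.
by rewrite cabsR // exprn_ge0.
Qed.

Lemma conj_pow2V (R : realType) n : Num.conj ((2 : R[i]) ^- n) = 2 ^- n.
Proof. by rewrite fmorphV rmorphXn /= rmorph_nat. Qed.

Lemma conj_pow2 (R : realType) n : Num.conj ((2 : R[i]) ^+ n) = 2 ^+ n.
Proof. by rewrite rmorphXn /= rmorph_nat. Qed.

Lemma pow2_neq0 (R : realType) n : (2 : R[i]) ^+ n != 0.
Proof. by rewrite expf_neq0 // pnatr_eq0. Qed.

Theorem theorem3p3 (R : realType) (A B : CstarAlg R)
    (Xi : HilbMod A) (Nb : HilbMod B) (f : Xi -> Nb)
    (phi : Xi -> Xi -> Xi -> R) (L : R) :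
  (forall x y z, 0 <= phi x y z) ->
  (forall (mu : R[i]) (x y : Xi), cabs mu = 1 ->
     hnorm (f (mu *: x + y) - mu *: f x - f y) <= phi x y 0) ->
  (forall x y z : Xi,
     hnorm (f (hm_act (hm_ip x y) z) - hm_act (hm_ip (f x) (f y)) (f z))
       <= phi x y z) ->
  (forall x y z : Xi,
     hnorm (f (hm_act (ca_star (hm_ip x y)) z)
            - hm_act (ca_star (hm_ip (f x) (f y))) (f z))
       <= phi x y z) ->
  0 <= L -> L < 1 ->
  (forall x y z : Xi,
     phi x y z <= L / 8 * phi (2 *: x) (2 *: y) (2 *: z)) ->
  exists H : Xi -> Nb,
    (is_hm_star_hom H /\
     forall x, hnorm (f x - H x) <= L / (8 - 8 * L) * phi x x 0) /\
    (forall H' : Xi -> Nb,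
       is_hm_star_hom H' /\
       (forall x, hnorm (f x - H' x) <= L / (8 - 8 * L) * phi x x 0) ->
       H' = H).
Proof.
move=> phi0 flin fmul _ L0 L1 phiL.
have nP := @hnorm_is_norm R B Nb.
have phin n x y z : phi (2 ^- n *: x) (2 ^- n *: y) (2 ^- n *: z)
    <= (L / 8) ^+ n * phi x y z.
  elim: n => [|n IH]; first by rewrite expr0 invr1 !scale1r mul1r.
  have e : (2 : R[i]) * 2 ^- n.+1 = 2 ^- n.
    by rewrite exprS invfM mulrA mulfV ?mul1r // pnatr_eq0.
  apply: le_trans (phiL _ _ _) _; rewrite !scalerA e exprS -[leRHS]mulrA.
  by rewrite ler_wpM2l // divr_ge0.
have phi0n n x y : phi (2 ^- n *: x) (2 ^- n *: y) 0 <= (L / 8) ^+ n * phi x y 0.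
  by have := phin n x y 0; rewrite scaler0.
pose u x n := (2 : R[i]) ^+ n *: f (2 ^- n *: x).
have pow2L n : 2 ^+ n * (L / 8) ^+ n = (L / 4) ^+ n.
  by rewrite -exprMn; congr (_ ^+ _); field.
have null4 K : 0 <= K -> null (fun n => K * (L / 4) ^+ n).
  by move=> K0; apply: nullMl => //; apply: null_expr; lra.
(* Sum of the geometric series with terms [L / 8 * (L / 4)^n], which bound the increments of [u x]
   up to the factor [phi x x 0]. *)
pose K := L / 8 / (1 - L / 4).
have K0 : 0 <= K by rewrite !divr_ge0 //; lra.
have lim x : exists l, tends (@hnorm R B Nb) (u x) l /\
    hnorm (f x - l) <= K * phi x x 0.
  have [||n|l ul l0] := @telescoping_limit R Nb (@hnorm R B Nb) (u x)
    (fun n => K * phi x x 0 * (L / 4) ^+ n) nP (@hm_complete R B Nb).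
  - by move=> n; apply: mulr_ge0; [exact: mulr_ge0|apply: exprn_ge0; lra].
  - by apply: null4; rewrite mulr_ge0.
  - pose w := 2 ^- n.+1 *: x.
    (* The increment is [2^n] times the additivity defect of [f] at [(w, w)], that is, the case
       [mu = 1]. *)
    have e : u x n - u x n.+1 = 2 ^+ n *: (f (1 *: w + w) - 1 *: f w - f w).
      have -> : 1 *: w + w = 2 ^- n *: x.
        rewrite scale1r -mulr2n -scaler_nat scalerA exprS invfM mulrA.
        by rewrite mulfV ?mul1r // pnatr_eq0.
      rewrite scale1r -addrA -opprD -mulr2n -[f w *+ 2]scaler_nat scalerBr scalerA.
      by rewrite -exprSr.
    rewrite e (nrmZ nP) cabs_pow2.
    have := flin 1 w w (ComplexField.Normc.normc1 _).
    have := phi0n n.+1 x x; rewrite -/w => h1 h2.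
    have h3 := le_trans h2 h1.
    have p2 : 0 <= (2 : R) ^+ n by rewrite exprn_ge0.
    apply: le_trans (ler_wpM2l p2 h3) _.
    have -> : 2 ^+ n * ((L / 8) ^+ n.+1 * phi x x 0)
        = 2 ^+ n * (L / 8) ^+ n * (L / 8) * phi x x 0 by rewrite exprSr !mulrA.
    (* By the choice of [K], the bound equals the difference of consecutive remainders. *)
    rewrite pow2L le_eqVlt [(L / 4) ^+ n.+1]exprSr.
    apply/orP; left; apply/eqP; rewrite /K; field.
    by apply/eqP; lra.
  exists l; split=> //.
  by move: l0; rewrite /u expr0 invr1 !scale1r mulr1.
have [H HP] := choice lim.
have uH x : tends (@hnorm R B Nb) (u x) (H x) by case: (HP x).
have Hmu mu x y : cabs mu = 1 -> H (mu *: x + y) = mu *: H x + H y.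
  move=> m1; apply: (tends_eq nP (uH _) (v := fun n => mu *: u x n + u y n)
    _ (null4 _ (phi0 x y 0))).
    by apply: (tendsD nP (u := fun n => mu *: u x n)) => //; exact: (tendsZ nP).
  move=> n; have -> : u (mu *: x + y) n - (mu *: u x n + u y n)
      = 2 ^+ n *: (f (mu *: (2 ^- n *: x) + 2 ^- n *: y)
                   - mu *: f (2 ^- n *: x) - f (2 ^- n *: y)).
    rewrite /u !scalerBr scalerDr !scalerA (mulrC mu) (mulrC mu).
    by rewrite opprD addrA.
  rewrite (nrmZ nP) cabs_pow2.
  have p2 : 0 <= (2 : R) ^+ n by rewrite exprn_ge0.
  apply: le_trans (ler_wpM2l p2 (le_trans (flin _ _ _ m1) (phi0n _ _ _))) _.
  by rewrite mulrA pow2L mulrC.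
have Hlin := unimodular_linear Hmu.
have Hmul x y z : H (hm_act (hm_ip x y) z) = hm_act (hm_ip (H x) (H y)) (H z).
  (* The product of three arguments scaled by [2^-n] is scaled by [8^-n], so the left side is
     followed along the indices [3n]. *)
  have t1 := tends_sub (k := fun n => (n + (n + n))%N) (fun n => leq_addr _ n)
    (uH (hm_act (hm_ip x y) z)).
  have t2 := tends_bilin nP nP (@ca_normP R B) (@hm_ipDl _ _ _) (@hm_ipDr _ _ _)
    (@ip_norm_le _ _ _) (uH x) (uH y).
  have t3 := tends_bilin (@ca_normP R B) nP nP (@hm_actDl _ _ _) (@hm_actDr _ _ _)
    (@hnorm_act_le _ _ _) t2 (uH z).
  have nL : null (fun n => phi x y z * L ^+ n).
    by apply: nullMl => //; exact: null_expr.
  apply: (tends_eq nP t1 t3 nL) => n /=.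
  have -> : u (hm_act (hm_ip x y) z) (n + (n + n))%N
      - hm_act (hm_ip (u x n) (u y n)) (u z n)
    = 2 ^+ (n + (n + n)) *:
      (f (hm_act (hm_ip (2 ^- n *: x) (2 ^- n *: y)) (2 ^- n *: z))
       - hm_act (hm_ip (f (2 ^- n *: x)) (f (2 ^- n *: y))) (f (2 ^- n *: z))).
    rewrite /u scalerBr !hm_ipZl !hm_ipZr !hm_actZr !hm_actZl !scalerA.
    rewrite conj_pow2 conj_pow2V !exprD !invfM !mulrA.
    by congr (_ - _ *: _); ring.
  rewrite (nrmZ nP) cabs_pow2.
  have p2 : 0 <= (2 : R) ^+ (n + (n + n)) by rewrite exprn_ge0.
  apply: le_trans (ler_wpM2l p2 (le_trans (fmul _ _ _) (phin _ _ _ _))) _.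
  rewrite mulrA mulrC ler_wpM2l // !exprD -!exprMn.
  by have -> : 2 * (2 * 2) * (L / 8) = L by field.
exists H; split; first split.
- split; first by split.
  (* As [<x,y>^* = <y,x>], this is multiplicativity with [x] and [y] exchanged. *)
  by move=> x y z; rewrite !hm_ipC Hmul.
(* [K] equals [L / (8 - 2 * L)], which is at most [L / (8 - 8 * L)]. *)
- move=> x; case: (HP x) => _ h; apply: le_trans h _; rewrite ler_wpM2r //.
  have a : 0 < 1 - L / 4 by lra.
  have b : 0 < 8 - 8 * L by lra.
  rewrite /K ler_pdivrMr // mulrAC ler_pdivlMr //; nra.
- move=> H' [[[H'lin _] _] H'f]; apply/funext => x.
  have H'0 : H' 0 = 0.
    apply: (addrI (H' 0)); have := H'lin 1 0 0.
    by rewrite !scale1r !addr0 => <-.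
  have H'Z l : H' (l *: x) = l *: H' x.
    by rewrite -[l *: x]addr0 H'lin H'0 addr0.
  set M := L / (8 - 8 * L) in H'f.
  have M0 : 0 <= M by rewrite divr_ge0 //; lra.
  (* Homogeneity of [H'] makes [u x n - H' x] equal to [2^n] times the error of [H'] at [2^-n x],
     which is at most [M * phi x x 0 * (L / 4)^n]. *)
  apply/esym/(tends_eq nP (uH x) (tends_cst nP (H' x)) (null4 (M * phi x x 0) _)).
    by rewrite mulr_ge0.
  move=> n.
  have -> : u x n - H' x = 2 ^+ n *: (f (2 ^- n *: x) - H' (2 ^- n *: x)).
    by rewrite scalerBr H'Z scalerA mulfV ?scale1r // pow2_neq0.
  rewrite (nrmZ nP) cabs_pow2.
  have p2 : 0 <= (2 : R) ^+ n by rewrite exprn_ge0.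
  apply: le_trans (ler_wpM2l p2 (H'f _)) _.
  rewrite mulrCA -[leRHS]mulrA; apply: ler_wpM2l => //.
  apply: le_trans (ler_wpM2l p2 (phi0n _ _ _)) _.
  by rewrite mulrA pow2L mulrC.
Qed.
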